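(* If the posets $(\mathrm{AP}_{\mathcal S},\le_{\mathcal S})$ and $(\mathrm{Ap}_1,\le_1)$ are isomorphic, then $\beta_i(k[\mathcal C])=\beta_i(k[\mathcal C_1])$ for all $i$.
   Context: Let $k$ be an infinite field, $d\ge 1$, and $0=a_0<a_1<\dots<a_n=d$ integers with $\gcd(a_1,\dots,a_n)=1$. Put $\mathbf a_i=(a_i,d-a_i)$. Let $\mathcal S_1\subseteq\mathbb N$ be the numerical semigroup generated by $a_1,\dots,a_n$ and $\mathcal S\subseteq\mathbb N^2$ the monoid generated by $\mathbf a_0,\dots,\mathbf a_n$. Partial orders: $y\le_1 z$ iff $z-y\in\mathcal S_1$; $\mathbf y\le_{\mathcal S}\mathbf z$ iff $\mathbf z-\mathbf y\in\mathcal S$. $\mathrm{Ap}_1=\{y\in\mathcal S_1:y-d\notin\mathcal S_1\}$, $\mathrm{AP}_{\mathcal S}=\{\mathbf y\in\mathcal S:\mathbf y-\mathbf a_0\notin\mathcal S,\ \mathbf y-\mathbf a_n\notin\mathcal S\}$, with induced orders. $k[\mathcal C]=k[x_0,\dots,x_n]/I_{\mathcal A}$ where $I_{\mathcal A}$ is the kernel of $x_i\mapsto u^{a_i}v^{d-a_i}$; $k[\mathcal C_1]=k[x_1,\dots,x_n]/I_{\mathcal A_1}$ where $I_{\mathcal A_1}$ is the kernel of $x_i\mapsto t^{a_i}$. $\beta_i$ denotes the $i$-th Betti number, i.e. the rank of the $i$-th free module in a minimal graded free resolution over the respective polynomial ring. *)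

(* Defs.v *)
From mathcomp Require Import all_boot all_order all_algebra.
From mathcomp Require Import mpoly.
Set Implicit Arguments. Unset Strict Implicit. Unset Printing Implicit Defensive.
Import GRing.Theory.
Local Open Scope ring_scope.

Definition inS1 (n : nat) (a : nat -> nat) (y : nat) : Prop :=
  exists c : nat -> nat, y = (\sum_(1 <= i < n.+1) c i * a i)%N.

Definition inS (n d : nat) (a : nat -> nat) (y : nat * nat) : Prop :=
  exists c : nat -> nat,
    y.1 = (\sum_(0 <= i < n.+1) c i * a i)%N /\
    y.2 = (\sum_(0 <= i < n.+1) c i * (d - a i))%N.

Definition le1 (n : nat) (a : nat -> nat) (y z : nat) : Prop :=
  (y <= z)%N /\ inS1 n a (z - y).

Definition leS (n d : nat) (a : nat -> nat) (y z : nat * nat) : Prop :=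
  (y.1 <= z.1)%N /\ (y.2 <= z.2)%N /\ inS n d a (z.1 - y.1, z.2 - y.2)%N.

Definition inAp1 (n d : nat) (a : nat -> nat) (y : nat) : Prop :=
  inS1 n a y /\ ~ le1 n a d y.

(* AP_S = { y \in S : y - a_0 \notin S, y - a_n \notin S },
   with a_0 = (0, d) and a_n = (d, 0) *)
Definition inAPS (n d : nat) (a : nat -> nat) (y : nat * nat) : Prop :=
  inS n d a y /\ ~ leS n d a (0, d)%N y /\ ~ leS n d a (d, 0)%N y.

Definition posets_iso (n d : nat) (a : nat -> nat) : Prop :=
  exists (f : nat * nat -> nat) (g : nat -> nat * nat),
    (forall y, inAPS n d a y -> inAp1 n d a (f y)) /\
    (forall z, inAp1 n d a z -> inAPS n d a (g z)) /\
    (forall y, inAPS n d a y -> g (f y) = y) /\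
    (forall z, inAp1 n d a z -> f (g z) = z) /\
    (forall y y', inAPS n d a y -> inAPS n d a y' ->
        leS n d a y y' <-> le1 n a (f y) (f y')).

Definition inIA (k : fieldType) (n d : nat) (a : nat -> nat)
    (p : {mpoly k[n.+1]}) : Prop :=
  mmap (fun c : k => c%:MP_[2])
       (fun i : 'I_n.+1 =>
          ('X_(@ord0 1) : {mpoly k[2]}) ^+ a i * 'X_(@ord_max 1) ^+ (d - a i)) p = 0.

(* I_{A_1} = kernel of k[x_1..x_n] -> k[t], x_i |-> t^{a_i};
   the variable of index j : 'I_n stands for x_{j+1}. *)
Definition inIA1 (k : fieldType) (n : nat) (a : nat -> nat)
    (p : {mpoly k[n]}) : Prop :=
  mmap (fun c : k => c%:MP_[1])
       (fun j : 'I_n => ('X_(@ord0 0) : {mpoly k[1]}) ^+ a j.+1) p = 0.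

Definition whomog (k : fieldType) (N : nat) (w : 'I_N -> nat) (e : nat)
    (p : {mpoly k[N]}) : Prop :=
  forall m : 'X_{1..N}, m \in msupp p -> (\sum_(i < N) w i * m i)%N = e.

(* A minimal graded free resolution of R/I, R = k[x_1..x_N] graded by w:
     ... -> F_2 --phi 1--> F_1 --phi 0--> F_0 = R -> R/I -> 0
   with F_i = (+)_{j < b i} R(-D i j).  Elements of F_i are row vectors
   'rV_(b i) and phi i : F_{i+1} -> F_i is v |-> v *m phi i.
   Graded of degree 0: entry (l, j) of phi i is homogeneous of degree
   D (i+1) l - D i j.  Minimal: all entries lie in the homogeneous maximal
   ideal (nonzero entries have positive degree). *)
Definition is_min_graded_res (k : fieldType) (N : nat) (w : 'I_N -> nat)
    (I : {mpoly k[N]} -> Prop)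
    (b : nat -> nat) (D : nat -> nat -> nat)
    (phi : forall i : nat, 'M[{mpoly k[N]}]_(b i.+1, b i)) : Prop :=
  [/\ b 0 = 1%N,
      (forall j : 'I_(b 0), D 0 j = 0%N),
      (forall i (l : 'I_(b i.+1)) (j : 'I_(b i)),
          phi i l j = 0 \/
          ((D i j < D i.+1 l)%N /\ whomog w (D i.+1 l - D i j) (phi i l j))),
      (forall v : 'rV[{mpoly k[N]}]_(b 0),
          (forall j, I (v 0 j)) <-> exists u : 'rV_(b 1), v = u *m phi 0)
    & (forall i (v : 'rV[{mpoly k[N]}]_(b i.+1)),
          v *m phi i = 0 <-> exists u : 'rV_(b i.+2), v = u *m phi i.+1)].

Definition betti_numbers (k : fieldType) (N : nat) (w : 'I_N -> nat)
    (I : {mpoly k[N]} -> Prop) (beta : nat -> nat) : Prop :=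
  exists (D : nat -> nat -> nat)
         (phi : forall i : nat, 'M[{mpoly k[N]}]_(beta i.+1, beta i)),
    is_min_graded_res w I D phi.

(* Main.v *)
Require Import Defs.
From mathcomp Require Import all_boot all_order all_algebra.
From mathcomp Require Import mpoly.
From HB Require Import structures.
From mathcomp Require Import zify.
From Stdlib Require Import ClassicalEpsilon.
Set Implicit Arguments. Unset Strict Implicit. Unset Printing Implicit Defensive.
Import GRing.Theory.
Local Open Scope ring_scope.

(** If all entries of a resolution lie in the maximal ideal at the origin, then
    its ranks are determined by the resolved ideal alone: comparison maps are
    invertible modulo that ideal. No grading is involved, so the standard
    grading of k[C] and the weighted one of k[C_1] can be compared. Moreover
    such a resolution stays one modulo a variable that is regular on the
    quotient ring.

    Every residue class mod d met by S_1 contains exactly one element of Ap_1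
    and at least one of AP_S, so |AP_S| = |Ap_1| makes the first projection
    pi : AP_S -> Ap_1 bijective. It preserves the orders, and since the two
    posets have equally many related pairs it also reflects them. Bijectivity
    makes (x_0, x_n) regular on k[C]; reflection makes pi identify
    k[C]/(x_0, x_n), with basis AP_S, with k[C_1]/(x_n), with basis Ap_1, as
    quotients of k[x_1, .., x_(n-1)]. So the resolutions of k[C] modulo
    (x_0, x_n) and of k[C_1] modulo x_n resolve the same ideal. *)

(** * Resolutions *)

(** Grading and minimality are left out, so that the notion survives a change of ring and covers
    both gradings. *)
Definition resolves (R : comNzRingType) (I : R -> Prop) (b : nat -> nat)
    (phi : forall i, 'M[R]_(b i.+1, b i)) : Prop :=
  [/\ b 0 = 1%N,
      forall v : 'rV[R]_(b 0),
        (forall j, I (v 0 j)) <-> exists u : 'rV_(b 1), v = u *m phi 0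
    & forall i (v : 'rV[R]_(b i.+1)),
        v *m phi i = 0 <-> exists u : 'rV_(b i.+2), v = u *m phi i.+1].

Lemma row_factor (R : comNzRingType) p q r (A : 'M[R]_(p, r)) (B : 'M[R]_(q, r)) :
  (forall l, exists u, row l A = u *m B) -> exists X : 'M_(p, q), A = X *m B.
Proof.
move=> /fin_all_exists [f Hf].
exists (\matrix_l f l); apply/row_matrixP => l.
by rewrite row_mul rowK -Hf.
Qed.

Definition quot_mx (R : comNzRingType) p q r (A : 'M[R]_(p, r)) (B : 'M[R]_(q, r)) :
  'M[R]_(p, q) := epsilon (inhabits 0) (fun X => A = X *m B).

Lemma quot_mxP (R : comNzRingType) p q r (A : 'M[R]_(p, r)) (B : 'M[R]_(q, r)) :
  (exists X, A = X *m B) -> A = quot_mx A B *m B.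
Proof. exact: (epsilon_spec (inhabits 0) (fun X => A = X *m B)). Qed.

(** * Comparison of two resolutions of the same ideal *)

Section Uniqueness.
Variables (R : comNzRingType) (I : R -> Prop).

Lemma resolves_factor b (phi : forall i, 'M[R]_(b i.+1, b i)) :
  resolves I phi -> forall i p (A : 'M_(p, b i.+1)),
  A *m phi i = 0 -> exists X : 'M_(p, b i.+2), A = X *m phi i.+1.
Proof.
case=> _ _ ex i p A A0; apply: row_factor => l.
by apply/ex; rewrite -row_mul A0 row0.
Qed.

Lemma resolves_comp b (phi : forall i, 'M[R]_(b i.+1, b i)) :
  resolves I phi -> forall i, phi i.+1 *m phi i = 0.
Proof.
case=> _ _ ex i; apply/row_matrixP => l; rewrite row0 row_mul.
by apply/ex; exists (delta_mx 0 l); rewrite rowE.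
Qed.

(** The all-ones matrix plays the identity in degree 0: [b 0] and [b' 0] equal 1 only
    propositionally. *)
Fixpoint lift_chain b b' (phi : forall i, 'M[R]_(b i.+1, b i))
    (phi' : forall i, 'M[R]_(b' i.+1, b' i)) i : 'M[R]_(b i, b' i) :=
  match i with
  | 0 => const_mx 1
  | j.+1 => quot_mx (phi j *m lift_chain phi phi' j) (phi' j)
  end.

Lemma lift_chainP b b' (phi : forall i, 'M[R]_(b i.+1, b i))
    (phi' : forall i, 'M[R]_(b' i.+1, b' i)) :
  resolves I phi -> resolves I phi' -> forall i,
  phi i *m lift_chain phi phi' i = lift_chain phi phi' i.+1 *m phi' i.
Proof.
move=> res res' i; rewrite [lift_chain _ _ i.+1]/=; apply: quot_mxP.
elim: i => [|i IH] /=.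
  apply: row_factor => l.
  case: (res) (res') => b0 ex0 _ [b0' ex0' _]; apply/ex0' => j.
  rewrite !mxE.
  have Hin : forall j, I (row l (phi 0) 0 j).
    by apply/ex0; exists (delta_mx 0 l); rewrite rowE.
  have {Hin}: forall j, I (phi 0 l j) by move=> j'; move: (Hin j'); rewrite mxE.
  move: (phi 0 l) => F IF.
  under eq_bigr do rewrite mxE mulr1.
  move: F IF; rewrite b0 => F IF.
  by rewrite big_ord1.
apply: (resolves_factor res').
rewrite -mulmxA -(quot_mxP IH).
by rewrite mulmxA (resolves_comp res) mul0mx.
Qed.

(** The composite of the two comparison maps is homotopic to the identity. Applying [eps] kills the
    homotopy terms, so the identity of [k^(b i)] factors through [k^(b' i)]. *)
Lemma min_resolution_rank_le (k : fieldType) (eps : {rmorphism R -> k})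
    b b' (phi : forall i, 'M[R]_(b i.+1, b i))
    (phi' : forall i, 'M[R]_(b' i.+1, b' i)) :
  resolves I phi -> resolves I phi' ->
  (forall i l j, eps (phi i l j) = 0) -> forall i, (b i <= b' i)%N.
Proof.
move=> res res' min i.
have min_mx j : map_mx eps (phi j) = 0 by apply/matrixP=> l c; rewrite !mxE min.
pose al := lift_chain phi phi'; pose al' := lift_chain phi' phi.
have alE j : phi j *m al j = al j.+1 *m phi' j by apply: lift_chainP.
have al'E j : phi' j *m al' j = al' j.+1 *m phi j by apply: lift_chainP.
pose ga j := 1%:M - al j *m al' j.
have gaE j : phi j *m ga j = ga j.+1 *m phi j.
  by rewrite mulmxBr mulmxBl mulmx1 mul1mx mulmxA alE -!mulmxA al'E.
have ga0 : ga 0 = 0.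
  apply/eqP; rewrite subr_eq0; apply/eqP.
  rewrite /al /al' /=; case: res res' => b0 _ _ [b0' _ _].
  move: (b 0) (b' 0) b0 b0' => _ _ -> ->.
  by apply/matrixP=> x y; rewrite !ord1 !mxE big_ord1 !mxE mulr1.
(* [h] is the homotopy at stage [j]; the first clause is what exactness needs to produce the next
   one. *)
have htpy j : exists2 h : 'M_(b j, b j.+1),
    phi j *m (ga j - h *m phi j) = 0 & map_mx eps (ga j) = 0.
  elim: j => [|j [h hj _]].
    by exists 0; rewrite ga0 ?map_mx0 // mul0mx subr0 mulmx0.
  have [h' h'E] : exists h' : 'M_(b j.+1, b j.+2),
      ga j.+1 - phi j *m h = h' *m phi j.+1.
    apply: (resolves_factor res).
    by rewrite mulmxBl -gaE -mulmxA -mulmxBr.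
  exists h'.
    by rewrite -h'E opprB addrC subrK mulmxA (resolves_comp res) mul0mx.
  have -> : ga j.+1 = h' *m phi j.+1 + phi j *m h by rewrite -h'E subrK.
  by rewrite map_mxD !map_mxM !min_mx mulmx0 mul0mx addr0.
have [_ _ /eqP] := htpy i.
rewrite /ga map_mxB map_mx1 subr_eq0 map_mxM => /eqP E1.
rewrite -(mxrank1 k (b i)) E1.
exact: mulmx_max_rank.
Qed.

End Uniqueness.

(** * Reduction of a resolution modulo a regular element *)

Section Descent.
Variables (R : idomainType) (R' : comNzRingType) (sg : {rmorphism R -> R'}).
Variables (io : R' -> R) (x : R).
Hypotheses (ioK : cancel io sg) (x_neq0 : x != 0) (sgx : sg x = 0).
Hypothesis ker_sg : forall p, sg p = 0 -> exists w, p = x * w.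

Lemma mx_ker_factor p q (A : 'M[R]_(p, q)) :
  map_mx sg A = 0 -> exists B, A = x *: B.
Proof.
move=> /matrixP A0.
have : forall l, exists w : 'rV_q, row l A = x *: w.
  move=> l; have [|w Hw] := fin_all_exists (P := fun j w => A l j = x * w).
    by move=> j; have := A0 l j; rewrite !mxE => /ker_sg.
  by exists (\row_j w j); apply/rowP => j; rewrite !mxE Hw.
move=> /fin_all_exists [w Hw].
exists (\matrix_l w l); apply/row_matrixP => l.
by rewrite Hw linearZ /= rowK.
Qed.

(** Lift a cycle to [v]; then [v *m phi i = x *: w], and regularity yields [w = w' *m phi i]. So
    [v - x *: w'] is a cycle over [R] with the same reduction. *)
Lemma resolves_descent (I : R -> Prop) b (phi : forall i, 'M[R]_(b i.+1, b i)) :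
  (forall p, I (x * p) -> I p) -> resolves I phi ->
  resolves (fun q => exists2 p, I p & q = sg p) (fun i => map_mx sg (phi i)).
Proof.
move=> regx res; case: (res) => b0 ex0 exS.
have liftK r (v : 'rV[R']_r) : map_mx sg (map_mx io v) = v.
  by apply/rowP => j; rewrite !mxE ioK.
have phi0I (u : 'rV_(b 1)) : forall j, I ((u *m phi 0) 0 j).
  by apply/ex0; exists u.
split=> //.
  move=> v; split.
    move=> /fin_all_exists2 [f If fE].
    have [|u uE] := (ex0 (\row_j f j)).1; first by move=> j; rewrite mxE.
    by exists (map_mx sg u); rewrite -map_mxM -uE; apply/rowP => j; rewrite !mxE.
  case=> u -> j; exists ((map_mx io u *m phi 0) 0 j); first exact: phi0I.
  by rewrite -[in LHS](liftK _ u) -map_mxM mxE.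
move=> i v; split; last first.
  case=> u ->; rewrite -mulmxA -map_mxM (resolves_comp res).
  by rewrite map_mx0 mulmx0.
rewrite -[v]liftK -map_mxM => /mx_ker_factor [w wE].
(* For [i = 0] the row [w] lies in the image because [x] is regular modulo [I]; otherwise [x]
   cancels in the domain [R], so [w] is a cycle. *)
have {wE} [w' w'E] : exists w', map_mx io v *m phi i = x *: (w' *m phi i).
  case: i => [|i] in v w wE *.
    have [|w' w'E] := (ex0 w).1; last by exists w'; rewrite wE w'E.
    by move=> j; apply: regx; have := phi0I (map_mx io v) j; rewrite wE mxE.
  have [|w' w'E] := (exS i w).1; last by exists w'; rewrite wE w'E.
  have : x *: (w *m phi i) = 0.
    by rewrite scalemxAl -wE -mulmxA (resolves_comp res) mulmx0.
  move=> /matrixP H; apply/matrixP => l j; have := H l j.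
  rewrite mxE [RHS]mxE => /eqP.
  by rewrite mulf_eq0 (negbTE x_neq0) /= => /eqP ->; rewrite mxE.
have [|u uE] := (exS i (map_mx io v - x *: w')).1.
  by rewrite mulmxBl w'E -scalemxAl subrr.
exists (map_mx sg u); rewrite -map_mxM -uE.
by apply/rowP => j; rewrite !mxE rmorphB rmorphM sgx mul0r subr0.
Qed.

End Descent.

(** * Toric ideals modulo variables *)

Definition wdeg N M (e : 'I_N -> 'X_{1..M}) (m : 'X_{1..N}) : 'X_{1..M} :=
  (\sum_(i < N) e i *+ m i)%MM.

Lemma wdegE N M (e : 'I_N -> 'X_{1..M}) m j :
  wdeg e m j = (\sum_(i < N) e i j * m i)%N.
Proof. by rewrite /wdeg mnm_sumE; apply: eq_bigr => i _; rewrite mulmnE. Qed.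

Lemma wdegD N M (e : 'I_N -> 'X_{1..M}) m m' :
  wdeg e (m + m') = (wdeg e m + wdeg e m')%MM.
Proof.
apply/mnmP => j; rewrite mnmDE !wdegE -big_split /=.
by apply: eq_bigr => i _; rewrite mnmDE mulnDr.
Qed.

Lemma wdegU N M (e : 'I_N -> 'X_{1..M}) i : wdeg e U_(i) = e i.
Proof.
apply/mnmP => j; rewrite wdegE (bigD1 i) //= mnm1E eqxx muln1 big1 ?addn0 //.
by move=> l /negbTE; rewrite eq_sym mnm1E => ->; rewrite muln0.
Qed.

Section Toric.
Variable k : fieldType.

Definition toric N M (e : 'I_N -> 'X_{1..M}) : {mpoly k[N]} -> {mpoly k[M]} :=
  mmap (@mpolyC M k) (fun i => 'X_[e i]).
HB.instance Definition _ N M (e : 'I_N -> 'X_{1..M}) :=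
  GRing.RMorphism.copy (toric e) (mmap (@mpolyC M k) (fun i => 'X_[e i])).

Lemma toricZ N M (e : 'I_N -> 'X_{1..M}) c p : toric e (c *: p) = c *: toric e p.
Proof. by rewrite /toric mmapZ mul_mpolyC. Qed.

Lemma toricX N M (e : 'I_N -> 'X_{1..M}) m : toric e 'X_[m] = 'X_[wdeg e m].
Proof.
rewrite /toric mmapX /mmap1 /wdeg -mprodXE.
by apply: eq_bigr => i _; rewrite mpolyXn.
Qed.

Lemma mcoeff_toric N M (e : 'I_N -> 'X_{1..M}) p t :
  (toric e p)@_t = \sum_(m <- msupp p) p@_m * (wdeg e m == t)%:R.
Proof.
rewrite {1}[p]mpolyE rmorph_sum raddf_sum /=; apply: eq_bigr => m _.
by rewrite toricZ toricX mcoeffZ mcoeffX.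
Qed.

Lemma mcoeff_toric_eq0 N M (e : 'I_N -> 'X_{1..M}) p t :
  (forall m, wdeg e m <> t) -> (toric e p)@_t = 0.
Proof.
move=> nt; rewrite mcoeff_toric big1 // => m _.
by case: eqP => [/nt|]; rewrite // mulr0.
Qed.

(** * Setting one variable to zero *)

Definition kill_var N (v i : 'I_N.+1) : {mpoly k[N]} :=
  if unlift v i is Some j then 'X_(j : 'I_N) else 0.

Definition kill N (v : 'I_N.+1) : {mpoly k[N.+1]} -> {mpoly k[N]} :=
  mmap (@mpolyC N k) (kill_var v).
HB.instance Definition _ N (v : 'I_N.+1) :=
  GRing.RMorphism.copy (kill v) (mmap (@mpolyC N k) (kill_var v)).

Lemma killZ N (v : 'I_N.+1) c p : kill v (c *: p) = c *: kill v p.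
Proof. by rewrite /kill mmapZ mul_mpolyC. Qed.

Lemma killXv N (v : 'I_N.+1) : kill v 'X_v = 0.
Proof. by rewrite /kill mmapX mmap1U /kill_var unlift_none. Qed.

Lemma killXlift N (v : 'I_N.+1) (j : 'I_N) : kill v 'X_(lift v j) = 'X_j.
Proof. by rewrite /kill mmapX mmap1U /kill_var liftK. Qed.

Local Notation widen_mpoly v := (toric (fun j => U_(lift v j)%MM)).

Lemma widen_mpolyK N (v : 'I_N.+1) : cancel (widen_mpoly v) (kill v).
Proof.
elim/mpolyind => [|c m p _ _ IH]; first by rewrite !rmorph0.
rewrite !rmorphD /= IH; congr (_ + _).
rewrite toricZ killZ toricX; congr (_ *: _).
rewrite /wdeg -mprodXE rmorph_prod /= [RHS]mpolyXE_id.
by apply: eq_bigr => i _; rewrite -mpolyXn rmorphXn /= killXlift.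
Qed.

Lemma kill_decomp N (v : 'I_N.+1) p :
  exists w, p = widen_mpoly v (kill v p) + 'X_v * w.
Proof.
elim/mpolyind: p => [|c m p _ _ [w IH]].
  by exists 0; rewrite !rmorph0 mulr0 addr0.
(* A monomial divisible by ['X_v] is absorbed in [w]; any other one survives the round trip
   unchanged. *)
have [mv0|mv] := eqVneq (m v) 0%N; last first.
  exists (c *: 'X_[m - U_(v)] + w).
  rewrite !rmorphD /= mulrDr -scalerAr -mpolyXD.
  rewrite [(U_(v) + _)%MM]addmC submK ?lep1mP //.
  have kXm : kill v 'X_[m] = 0.
    by rewrite -[m](@submK _ U_(v)%MM) ?lep1mP // mpolyXD rmorphM /= killXv mulr0.
  by rewrite killZ kXm scaler0 rmorph0 add0r addrCA -IH.
exists w; rewrite rmorphD /= rmorphD /= -addrA -IH; congr (_ + _).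
rewrite killZ toricZ; congr (_ *: _).
rewrite [in RHS]mpolyXE_id (bigD1_ord v) //= mv0 expr0 mul1r !rmorph_prod /=.
rewrite [LHS]mpolyXE_id (bigD1_ord v) //= mv0 expr0 mul1r.
apply: eq_bigr => i _; rewrite !rmorphXn /= killXlift.
by rewrite toricX wdegU.
Qed.

Lemma kill_eq0 N (v : 'I_N.+1) p : kill v p = 0 -> exists w, p = 'X_v * w.
Proof.
have [w pE] := kill_decomp v p => kp0.
by exists w; rewrite pE kp0 rmorph0 add0r.
Qed.

(** This keeps the entries of a minimal resolution in the maximal ideal at the origin after
    reduction. *)
Lemma mcoeff0_kill N (v : 'I_N.+1) p : (kill v p)@_0%MM = p@_0%MM.
Proof.
elim/mpolyind: p => [|c m p _ _ IH]; first by rewrite rmorph0 !mcoeff0.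
rewrite !rmorphD /= IH killZ !mcoeffZ; congr (c * _ + _).
rewrite mpolyXE_id rmorph_prod (big_morph _ (rmorphM _) (rmorph1 _)) /=.
rewrite [RHS](big_morph _ (rmorphM _) (rmorph1 _)) /=.
apply: eq_bigr => i _; rewrite !rmorphXn /=; congr (_ ^+ _).
by case: (unliftP v i) => [j|] ->; rewrite ?killXlift ?killXv !mcoeffX ?mcoeff0 !mnm1_eq0.
Qed.

Lemma toric_widen N (v : 'I_N.+1) M (e : 'I_N.+1 -> 'X_{1..M}) q :
  toric e (widen_mpoly v q) = toric (e \o lift v) q.
Proof.
elim/mpolyind: q => [|c m p _ _ IH]; first by rewrite !rmorph0.
rewrite !rmorphD /= IH !toricZ; congr (_ *: _ + _).
rewrite !toricX; congr ('X_[_]).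
rewrite {2}/wdeg (big_morph _ (wdegD e) (id1 := 0%MM)); last first.
  by apply/mnmP => j; rewrite wdegE mnm0E big1 // => i _; rewrite mnm0E muln0.
apply: eq_bigr => i _ /=.
elim: (m i) => [|r IHr]; last by rewrite !mulmS wdegD IHr wdegU.
by apply/mnmP => j; rewrite wdegE mnm0E big1 // => l _; rewrite mulm0n mnm0E muln0.
Qed.

(* The span of the monomials of weight outside [G], plus the toric ideal. *)
Definition toric_ideal N M (e : 'I_N -> 'X_{1..M}) (G : 'X_{1..M} -> Prop)
    (p : {mpoly k[N]}) : Prop :=
  forall t, G t -> (toric e p)@_t = 0.

(** [p] and the widened [kill v p] differ by a multiple of ['X_v], whose image lives in degrees
    [wdeg e m + e v]. *)
Lemma mcoeff_toric_kill N (v : 'I_N.+1) M (e : 'I_N.+1 -> 'X_{1..M}) p t :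
  (forall m, (wdeg e m + e v)%MM <> t) ->
  (toric (e \o lift v) (kill v p))@_t = (toric e p)@_t.
Proof.
move=> nt; have [w pE] := kill_decomp v p.
rewrite [in RHS]pE rmorphD /= toric_widen mcoeffD [X in _ + X](_ : _ = 0) ?addr0 //.
rewrite [w]mpolyE mulr_sumr rmorph_sum raddf_sum big1 //= => m _.
rewrite -scalerAr -mpolyXD toricZ toricX mcoeffZ mcoeffX wdegD wdegU addmC.
by case: eqP => [/nt|]; rewrite // mulr0.
Qed.

Lemma toric_idealTE N M (e : 'I_N -> 'X_{1..M}) p :
  toric_ideal e (fun=> True) p <-> toric e p = 0.
Proof.
split=> [H|H t _]; last by rewrite H mcoeff0.
by apply/mpolyP => t; rewrite mcoeff0 H.
Qed.

(* Modulo X_v, a degree reached by a multiple of X_v stops imposing a condition. *)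
Lemma kill_toric_ideal N (v : 'I_N.+1) M (e : 'I_N.+1 -> 'X_{1..M}) G q :
  (exists2 p, toric_ideal e G p & q = kill v p) <->
  toric_ideal (e \o lift v)
    (fun t => G t /\ forall m, (wdeg e m + e v)%MM <> t) q.
Proof.
split=> [[p Jp ->] t [Gt nt]|Jq]; first by rewrite mcoeff_toric_kill // Jp.
(* Lift [q] with zero coefficient in every degree reached by a multiple of ['X_v]; the other degrees
   are controlled by [q]. *)
have [p pq hit] : exists2 p, kill v p = q &
    forall m, (toric e p)@_(wdeg e m + e v) = 0.
  elim/mpolyind: (q) => [|c m r _ _ [p pr IH]].
    by exists 0; rewrite rmorph0 // => m; rewrite mcoeff0.
  have [p' p'm hit] : exists2 p', kill v p' = 'X_[m] &
      forall m', (toric e p')@_(wdeg e m' + e v) = 0.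
    have [[m' m'E]|nm'] := excluded_middle_informative
      (exists m', (wdeg e m' + e v)%MM = wdeg (e \o lift v) m).
      (* The subtracted monomial has the same degree and is sent to 0 by [kill v]. *)
      exists (widen_mpoly v 'X_[m] - 'X_v * 'X_[m']) => [|m''].
        by rewrite rmorphB rmorphM /= widen_mpolyK killXv mul0r subr0.
      rewrite rmorphB -mpolyXD /= toric_widen !toricX.
      by rewrite wdegD wdegU [(e v + _)%MM]addmC m'E subrr mcoeff0.
    exists (widen_mpoly v 'X_[m]) => [|m']; first exact: widen_mpolyK.
    rewrite toric_widen toricX mcoeffX; case: eqP => // E.
    by case: nm'; exists m'.
  exists (c *: p' + p) => [|m'].
    by rewrite rmorphD /= killZ p'm pr.
  by rewrite rmorphD /= toricZ mcoeffD mcoeffZ hit IH mulr0 addr0.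
exists p => // t Gt.
have [[m <-]|nm] := excluded_middle_informative
  (exists m, (wdeg e m + e v)%MM = t); first exact: hit.
have nt m : (wdeg e m + e v)%MM <> t by move=> E; apply: nm; exists m.
by rewrite -(mcoeff_toric_kill _ nt) pq Jq.
Qed.

(** The coefficient of the image of [p] at [t] reappears at [t + e v] in that of ['X_v * p], so [G]
    has to be stable under this shift. *)
Lemma toric_ideal_mulX N M (e : 'I_N -> 'X_{1..M}) G v p :
  (forall m, G (wdeg e m) -> G (wdeg e m + e v)%MM) ->
  toric_ideal e G ('X_v * p) -> toric_ideal e G p.
Proof.
move=> HG Jp t Gt.
have [[m mt]|nm] := excluded_middle_informative (exists m, wdeg e m = t).
  have := Jp (t + e v)%MM; rewrite -mt in Gt * => /(_ (HG _ Gt)).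
  by rewrite rmorphM /= toricX wdegU mulrC addmC mcoeffMX.
by apply: mcoeff_toric_eq0 => m mt; apply: nm; exists m.
Qed.

Lemma toric_regular N M (e : 'I_N -> 'X_{1..M}) v (p : {mpoly k[N]}) :
  toric_ideal e (fun=> True) ('X_v * p) -> toric_ideal e (fun=> True) p.
Proof. exact: toric_ideal_mulX. Qed.

(** Each coefficient of a toric image sums those of [p] over the monomials of one weight; the
    hypotheses make these fibres agree over good degrees. *)
Lemma toric_ideal_sub N M M1 (e : 'I_N -> 'X_{1..M}) (e1 : 'I_N -> 'X_{1..M1})
    G G1 p :
  (forall m, G1 (wdeg e1 m) -> G (wdeg e m)) ->
  (forall m m', G1 (wdeg e1 m) -> G1 (wdeg e1 m') ->
     wdeg e m = wdeg e m' <-> wdeg e1 m = wdeg e1 m') ->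
  (forall m, G (wdeg e m) -> G1 (wdeg e1 m)) ->
  toric_ideal e G p -> toric_ideal e1 G1 p.
Proof.
move=> sG inj sG1 Jp t Gt.
have [[m mt]|nm] := excluded_middle_informative (exists m, wdeg e1 m = t).
  rewrite -mt in Gt *; rewrite -[RHS](Jp _ (sG _ Gt)) !mcoeff_toric.
  apply: eq_bigr => m' _; congr (_ * (nat_of_bool _)%:R).
  apply/eqP/eqP => E.
    by apply/inj; rewrite ?E.
  by apply/inj => //; apply: sG1; rewrite E; apply: sG.
by apply: mcoeff_toric_eq0 => m mt; apply: nm; exists m.
Qed.

End Toric.

Local Close Scope ring_scope.

(** * Apery sets *)

Definition asbool (P : Prop) : bool :=
  if excluded_middle_informative P then true else false.

Lemma asboolP (P : Prop) : reflect P (asbool P).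
Proof.
by rewrite /asbool; case: excluded_middle_informative => h; constructor.
Qed.

Lemma enum_residues (P : nat -> Prop) d : 0 < d ->
  (forall z z', P z -> P z' -> z = z' %[mod d] -> z = z') ->
  exists L : seq nat, forall z, z \in L <-> P z.
Proof.
move=> d0 inj.
(* [rep r] is arbitrary when [P] misses the class [r]; the filter discards such values. *)
pose rep r := epsilon (inhabits 0) (fun z => P z /\ z %% d = r).
exists [seq z <- map rep (iota 0 d) | asbool (P z)] => z.
rewrite mem_filter; split=> [/andP[/asboolP//]|Pz].
apply/andP; split; first exact/asboolP.
have [Pr rE] : P (rep (z %% d)) /\ rep (z %% d) %% d = z %% d.
  by apply: (epsilon_spec (inhabits 0) (fun z' => P z' /\ z' %% d = z %% d)); exists z.
rewrite -[z](inj _ _ Pr Pz rE).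
by apply: map_f; rewrite mem_iota add0n ltn_mod.
Qed.

Section Semigroups.
Variables (n d : nat) (a : nat -> nat).
Hypotheses (d_ge1 : 1 <= d) (a0 : a 0 = 0) (an : a n = d).
Hypothesis a_incr : forall i, i < n -> a i < a i.+1.

Lemma a_lt i j : i < j -> j <= n -> a i < a j.
Proof.
elim: j => // j IH; rewrite ltnS leq_eqVlt => /orP[/eqP-> |lt_ij] jn.
  exact: a_incr.
exact: ltn_trans (IH lt_ij (ltnW jn)) (a_incr jn).
Qed.

Lemma inS0 : inS n d a (0, 0).
Proof. by exists (fun=> 0); rewrite !big1. Qed.

Lemma inS_add u v u' v' :
  inS n d a (u, v) -> inS n d a (u', v') -> inS n d a (u + u', v + v').
Proof.
move=> [c [/= -> ->]] [c' [/= -> ->]]; exists (fun i => c i + c' i) => /=.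
by rewrite -!big_split /=; split; apply: eq_bigr => i _; rewrite mulnDl.
Qed.

Lemma inS_muln u v l : inS n d a (u, v) -> inS n d a (l * u, l * v).
Proof.
move=> Suv; elim: l => [|l IH]; first exact: inS0.
by rewrite !mulSn; apply: inS_add.
Qed.

Lemma inS_gen i : i <= n -> inS n d a (a i, d - a i).
Proof.
move=> le_in; exists (fun j => (j == i) : nat).
have sumE (F : nat -> nat) : F i = \sum_(0 <= j < n.+1) (j == i) * F j.
  rewrite big_mkord (bigD1 (Ordinal (le_in : i < n.+1))) //= eqxx mul1n.
  rewrite big1 ?addn0 // => j.
  by rewrite -val_eqE /= => /negbTE ->.
by split; apply: sumE.
Qed.

Lemma inS_left : inS n d a (0, d).
Proof. by have := @inS_gen 0 (leq0n _); rewrite a0 subn0. Qed.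

Lemma inS_right : inS n d a (d, 0).
Proof. by have := inS_gen (leqnn n); rewrite an subnn. Qed.

Lemma inS_inS1 u v : inS n d a (u, v) -> inS1 n a u.
Proof. by move=> [c [/= -> _]]; exists c; rewrite big_ltn // a0 muln0. Qed.

Lemma inS1_inS u : inS1 n a u -> exists v, inS n d a (u, v).
Proof.
move=> [c ->]; exists (\sum_(0 <= i < n.+1) c i * (d - a i)); exists c => /=.
by rewrite [in RHS]big_ltn // a0 muln0.
Qed.

Lemma inS1_add u v : inS1 n a u -> inS1 n a v -> inS1 n a (u + v).
Proof.
move=> /inS1_inS[w Sw] /inS1_inS[w' Sw'].
exact: inS_inS1 (inS_add Sw Sw').
Qed.

Lemma inS1_muld l : inS1 n a (l * d).
Proof. exact: inS_inS1 (inS_muln l inS_right). Qed.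

Lemma leSE y1 y2 z1 z2 : leS n d a (y1, y2) (z1, z2) <->
  exists s1 s2, [/\ inS n d a (s1, s2), z1 = y1 + s1 & z2 = y2 + s2].
Proof.
split=> [[/= le1 [le2 S]]|[s1 [s2 [S -> ->]]]].
  by exists (z1 - y1), (z2 - y2); rewrite !subnKC.
by rewrite /leS /= !leq_addr !addKn.
Qed.

Lemma le1E y z : le1 n a y z <-> exists2 s, inS1 n a s & z = y + s.
Proof.
split=> [[le S]|[s S ->]]; first by exists (z - y); rewrite ?subnKC.
by rewrite /le1 leq_addr addKn.
Qed.

(** Remove [(0, d)] or [(d, 0)] while the result stays in S; each removal lowers [u + v] by [d]. *)
Lemma inAPS_decomp u v : inS n d a (u, v) ->
  exists b1 b2 c e, [/\ inAPS n d a (b1, b2), u = b1 + e * d & v = b2 + c * d].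
Proof.
have [N] := ubnP (u + v); elim: N u v => // N IH u v ltN Suv.
have [/leSE[s1 [s2 [Ss uE vE]]]|n1] := excluded_middle_informative
  (leS n d a (0, d) (u, v)).
  have [|b1 [b2 [c [e [Hb E1 E2]]]]] := IH s1 s2 _ Ss; first by lia.
  by exists b1, b2, c.+1, e; split=> //; rewrite ?uE ?vE ?E1 ?E2 // mulSn; lia.
have [/leSE[s1 [s2 [Ss uE vE]]]|n2] := excluded_middle_informative
  (leS n d a (d, 0) (u, v)).
  have [|b1 [b2 [c [e [Hb E1 E2]]]]] := IH s1 s2 _ Ss; first by lia.
  by exists b1, b2, c, e.+1; split=> //; rewrite ?uE ?vE ?E1 ?E2 // mulSn; lia.
by exists u, v, 0, 0; split=> //; rewrite mul0n addn0.
Qed.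

Lemma inAp1_sub z s l : inAp1 n d a z -> inS1 n a s -> z = s + l * d -> l = 0.
Proof.
case=> _ nle Ss; case: l => // l zE; case: nle; apply/le1E.
exists (s + l * d); last by rewrite zE mulSn; lia.
exact: inS1_add Ss (inS1_muld l).
Qed.

Lemma modn_eqP z z' : z <= z' -> z = z' %[mod d] -> exists l, z' = z + l * d.
Proof.
move=> le E; have /dvdnP[l lE] : d %| z' - z by rewrite -eqn_mod_dvd // E.
by exists l; rewrite -lE subnKC.
Qed.

Lemma inAp1_inj z z' : inAp1 n d a z -> inAp1 n d a z' ->
  z = z' %[mod d] -> z = z'.
Proof.
wlog le : z z' / z <= z' => [wl Az Az' E|Az Az' E].
  by case/orP: (leq_total z z') => le; [|symmetry]; apply: wl.
have [l lE] := modn_eqP le E.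
by have l0 := inAp1_sub Az' Az.1 lE; rewrite lE l0 addn0.
Qed.

Lemma inAp1_down z s t : inAp1 n d a z -> inS1 n a s -> inS1 n a t ->
  z = s + t -> inAp1 n d a s.
Proof.
move=> [_ nle] Ss St zE; split=> // /le1E[r Sr sE]; apply: nle; apply/le1E.
by exists (r + t); [exact: inS1_add | rewrite zE sE addnA].
Qed.

Lemma inAPS_down z1 z2 s1 s2 t1 t2 : inAPS n d a (z1, z2) ->
  inS n d a (s1, s2) -> inS n d a (t1, t2) -> z1 = s1 + t1 -> z2 = s2 + t2 ->
  inAPS n d a (s1, s2).
Proof.
move=> [_ [nle nle']] Ss St E1 E2; split=> //; split.
  move=> /leSE[r1 [r2 [Sr F1 F2]]]; apply: nle; apply/leSE.
  exists (r1 + t1), (r2 + t2); split; [exact: inS_add | lia | lia].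
move=> /leSE[r1 [r2 [Sr F1 F2]]]; apply: nle'; apply/leSE.
exists (r1 + t1), (r2 + t2); split; [exact: inS_add | lia | lia].
Qed.

Lemma inAPS_gen i : 0 < i < n -> inAPS n d a (a i, d - a i).
Proof.
move=> /andP[i0 lt_in]; split; first exact/inS_gen/ltnW.
have ai0 : 0 < a i by rewrite -a0 a_lt // ltnW.
have aid : a i < d by rewrite -an a_lt.
by split=> -[/= ? [? _]]; lia.
Qed.

(** Decompose any point of S above [z]: removing a copy of [(d, 0)] would put [z - d] in S_1, so the
    first coordinate is still [z]. *)
Lemma inAPS_lift z : inAp1 n d a z -> exists w, inAPS n d a (z, w).
Proof.
move=> Az; have [w] := inS1_inS Az.1.
move=> /inAPS_decomp[b1 [b2 [c [e [Hb zE _]]]]].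
have e0 := inAp1_sub Az (inS_inS1 Hb.1) zE.
by exists b2; rewrite zE e0 addn0.
Qed.

Lemma inAPS0 : inAPS n d a (0, 0).
Proof.
split; first exact: inS0.
by split=> -[/= ? [? _]]; lia.
Qed.

(** * Consequences of the poset isomorphism *)

Section Isomorphism.
Hypothesis iso : posets_iso n d a.

(** A chosen right inverse of the first projection; [inAPS_lift_Ap] makes the choice unique. *)
Definition lift_Ap z := (z, epsilon (inhabits 0) (fun w => inAPS n d a (z, w))).

Lemma lift_ApP z : inAp1 n d a z -> inAPS n d a (lift_Ap z).
Proof.
by move=> /inAPS_lift; apply: (epsilon_spec _ (fun w => inAPS n d a (z, w))).
Qed.

(* [f \o lift_Ap] is an injective self-map of the finite set Ap_1, hence onto,
   so every element of AP_S is a value of [lift_Ap]. *)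
Lemma inAPS_lift_Ap y : inAPS n d a y ->
  inAp1 n d a y.1 /\ y = lift_Ap y.1.
Proof.
have [L LP] := enum_residues d_ge1 inAp1_inj.
have [f [g [fP [gP [fK [gK f_le]]]]]] := iso.
pose U := undup L; pose h z := f (lift_Ap z).
have UP z : z \in U <-> inAp1 n d a z by rewrite mem_undup; apply: LP.
have hU : {subset map h U <= U}.
  by move=> _ /mapP[z /UP Az ->]; apply/UP/fP/lift_ApP.
have h_inj : {in U &, injective h}.
  move=> z z' /UP Az /UP Az' /(congr1 g).
  by rewrite /h !fK; [case | exact: lift_ApP | exact: lift_ApP].
have [||_ hUE] := uniq_min_size _ hU.
- by rewrite map_inj_in_uniq ?undup_uniq.
- by rewrite size_map.
move=> Ay; have /UP := fP _ Ay; rewrite -hUE => /mapP[z /UP Az fE].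
by have := congr1 g fE; rewrite /h !fK //; [move=> -> | exact: lift_ApP].
Qed.

Lemma inAPS_inj y y' : inAPS n d a y -> inAPS n d a y' ->
  y.1 = y'.1 %[mod d] -> y = y'.
Proof.
move=> /inAPS_lift_Ap[Ay ->] /inAPS_lift_Ap[Ay' ->] /= E.
by rewrite (inAp1_inj Ay Ay' E).
Qed.

(* The first projection AP_S -> Ap_1 preserves the order; both orders being
   finite with equally many related pairs, it also reflects it. *)
Lemma lift_Ap_le z z' : inAp1 n d a z -> inAp1 n d a z' ->
  le1 n a z z' -> leS n d a (lift_Ap z) (lift_Ap z').
Proof.
have [L LP] := enum_residues d_ge1 inAp1_inj.
have [f [g [fP [gP [fK [gK f_le]]]]]] := iso.
pose P := undup (allpairs pair L L).
have PP x : x \in P <-> inAp1 n d a x.1 /\ inAp1 n d a x.2.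
  rewrite mem_undup; split=> [/allpairsP[y [/LP ? /LP ? ->]] //|[/LP A /LP A']].
  by apply/allpairsP; exists x; case: (x) A A'.
pose A1 := [seq x <- P | asbool (le1 n a x.1 x.2)].
pose A2 := [seq x <- P | asbool (leS n d a (lift_Ap x.1) (lift_Ap x.2))].
pose h x := f (lift_Ap x).
have A21 : {subset A2 <= A1}.
  move=> x; rewrite !mem_filter => /andP[/asboolP H ->]; rewrite andbT.
  apply/asboolP; case: H => /= le [_ S]; split=> //.
  exact: inS_inS1 S.
(* As [f] and [g] match related pairs, every pair of [A1] is the image under [h] of a pair of
   [A2]. *)
have sz : size A1 <= size A2.
  rewrite -(size_map (fun x => (h x.1, h x.2)) A2).
  apply: uniq_leq_size; first by rewrite filter_uniq ?undup_uniq.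
  move=> [x x']; rewrite mem_filter => /andP[/asboolP /= le /PP[/= Ax Ax']].
  have [Gx Gx'] := (gP _ Ax, gP _ Ax').
  have [[B E] [B' E']] := (inAPS_lift_Ap Gx, inAPS_lift_Ap Gx').
  apply/mapP; exists ((g x).1, (g x').1); last by rewrite /h /= -E -E' !gK.
  rewrite mem_filter; apply/andP; split; last exact/PP.
  by apply/asboolP; rewrite /= -E -E'; apply/f_le => //; rewrite !gK.
have [|_ AE] := uniq_min_size _ A21 sz; first by rewrite filter_uniq ?undup_uniq.
move=> Az Az' le.
have : (z, z') \in A2.
  by rewrite AE mem_filter; apply/andP; split; [apply/asboolP | apply/PP].
by rewrite mem_filter => /andP[/asboolP].
Qed.

(** By order reflection, the lift of [u + a i] minus [(u, v)] is an element [(a i, s2)] of S. Lying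
    below an element of AP_S, it is in AP_S, and injectivity modulo [d] identifies it with the
    generator. *)
Lemma inAPS_step u v i : 0 < i < n -> inAPS n d a (u, v) ->
  inAp1 n d a (u + a i) -> inAPS n d a (u + a i, v + (d - a i)).
Proof.
move=> i_in Ab Az.
have Sai := inS_gen (ltnW (proj2 (andP i_in))).
have [Au uE] := inAPS_lift_Ap Ab.
have le : le1 n a u (u + a i) by apply/le1E; exists (a i) => //; exact: inS_inS1 Sai.
have := lift_Ap_le Au Az le; rewrite -uE.
have := lift_ApP Az; rewrite /lift_Ap.
move: (epsilon _ _) => w Aw /leSE[s1 [s2 [Ss /addnI E1 E2]]].
rewrite -E1 in Ss.
have As : inAPS n d a (a i, s2).
  by apply: (inAPS_down Aw Ss Ab.1); [rewrite addnC | rewrite E2 addnC].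
have [E] := inAPS_inj As (inAPS_gen i_in) (erefl _).
by rewrite -E -E2.
Qed.

(* This is where Cohen-Macaulayness enters: since AP_S is injective mod d, S is
   free over N(0,d) + N(d,0). *)
Lemma not_leS_left_add u v : inS n d a (u, v) -> ~ leS n d a (0, d) (u, v) ->
  ~ leS n d a (0, d) (u + d, v).
Proof.
move=> /inAPS_decomp[b1 [b2 [c [e [Hb uE vE]]]]] nle.
move=> /leSE[s1 [s2 [/inAPS_decomp[b1' [b2' [c' [e' [Hb' uE' vE']]]]] F1 F2]]].
have bE : (b1, b2) = (b1', b2').
  apply: inAPS_inj => //=.
  rewrite -(modnMDl e b1 d) -(modnMDl e' b1' d).
  rewrite addnC -uE [e' * d + _]addnC -uE' -(modnDr u).
  by rewrite F1.
case: bE => E1 E2.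
(* [c = 0] would give [b2 = d + b2 + c' * d]; hence a copy of [(0, d)] can already be removed from
   [(u, v)]. *)
case: c vE => [|c] vE; first by lia.
apply: nle; apply/leSE; exists (b1 + e * d), (b2 + c * d); split.
- apply: inS_add Hb.1 _.
  have := inS_add (inS_muln e inS_right) (inS_muln c inS_left).
  by rewrite !muln0 addn0.
- by rewrite uE.
- by rewrite vE mulSn; lia.
Qed.

End Isomorphism.
End Semigroups.

(** * Comparison of the two cones *)

Section Weights.
Variables (n d : nat) (a : nat -> nat).

Definition pr (t : 'X_{1..2}) : nat * nat := (t ord0, t ord_max).

Definition gen2 i : 'X_{1..2} := [multinom if j == ord0 then a i else d - a i | j < 2].

Definition gen1 i : 'X_{1..1} := [multinom a i | _ < 1].

Lemma pr_inj : injective pr.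
Proof.
move=> s t [E0 E1]; apply/mnmP => -[[|[|//]] i2].
  by rewrite (_ : Ordinal i2 = ord0) //; apply: val_inj.
by rewrite (_ : Ordinal i2 = ord_max) //; apply: val_inj.
Qed.

Lemma mnm1_inj (s t : 'X_{1..1}) : s ord0 = t ord0 -> s = t.
Proof. by move=> E; apply/mnmP => i; rewrite ord1. Qed.

Lemma prD s t : pr (s + t)%MM = ((pr s).1 + (pr t).1, (pr s).2 + (pr t).2).
Proof. by rewrite /pr !mnmDE. Qed.

Lemma pr_gen2 i : pr (gen2 i) = (a i, d - a i).
Proof. by rewrite /pr !mnmE. Qed.

Lemma wdeg_inS N (f : 'I_N -> nat) x : (forall i, f i <= n) ->
  inS n d a (pr (wdeg (gen2 \o f) x)).
Proof.
move=> f_le; rewrite /wdeg; apply: (big_ind (fun t => inS n d a (pr t))).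
- by rewrite /pr !mnm0E; apply: inS0.
- by move=> s t Ss St; rewrite prD; apply: inS_add.
- move=> i _; have := inS_muln (x i) (inS_gen d a (f_le i)).
  by rewrite /pr /= !mulmnE !mnmE ![_ * x i]mulnC.
Qed.

Lemma inS_wdeg y : inS n d a y ->
  exists x : 'X_{1..n.+1}, pr (wdeg (gen2 \o @nat_of_ord _) x) = y.
Proof.
case: y => u v [c [/= -> ->]]; exists [multinom c i | i < n.+1].
rewrite /pr !wdegE !big_mkord.
by congr pair; apply: eq_bigr => i _; rewrite !mnmE mulnC.
Qed.

Lemma wdeg_inS1 N (f : 'I_N -> nat) x : a 0 = 0 -> (forall i, f i <= n) ->
  inS1 n a (wdeg (gen1 \o f) x ord0).
Proof.
move=> a0 f_le; have := inS_inS1 a0 (wdeg_inS x f_le).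
by rewrite /pr !wdegE; congr (inS1 _ _ _); apply: eq_bigr => i _; rewrite !mnmE.
Qed.

Lemma inS1_wdeg y : inS1 n a y ->
  exists x : 'X_{1..n}, wdeg (gen1 \o (fun j : 'I_n => j.+1)) x ord0 = y.
Proof.
case=> c ->; exists [multinom c i.+1 | i < n].
rewrite wdegE big_add1 big_mkord; apply: eq_bigr => i _.
by rewrite !mnmE mulnC.
Qed.

Section Cone.
Variable k : fieldType.

Lemma eq_mmap N (S : comNzRingType) (f : {rmorphism k -> S}) (h h' : 'I_N -> S)
    (p : {mpoly k[N]}) : h =1 h' -> mmap f h p = mmap f h' p.
Proof.
by move=> E; apply: eq_bigr => m _; congr (_ * _)%R; apply: mmap1_eq.
Qed.

Lemma inIA_toric (p : {mpoly k[n.+1]}) :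
  inIA d a p <-> toric (gen2 \o @nat_of_ord n.+1) p = 0%R.
Proof.
rewrite /inIA /toric (eq_mmap _ (h' := fun i : 'I_n.+1 => 'X_[gen2 i]%R)) //.
move=> i; rewrite !mpolyXn -mpolyXD; congr ('X_[_])%R.
by apply: pr_inj; rewrite prD pr_gen2 /pr !mulmnE !mnm1E /= !mul0n !mul1n addn0.
Qed.

Lemma inIA1_toric (p : {mpoly k[n]}) :
  inIA1 a p <-> toric (gen1 \o (fun j : 'I_n => j.+1)) p = 0%R.
Proof.
rewrite /inIA1 /toric (eq_mmap _ (h' := fun j : 'I_n => 'X_[gen1 j.+1]%R)) //.
move=> i; rewrite mpolyXn; congr ('X_[_])%R.
by apply: mnm1_inj; rewrite mulmnE mnm1E eqxx mul1n mnmE.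
Qed.

End Cone.
End Weights.

(** * Degrees surviving modulo x_0 and x_n *)

Section Comparison.
Variables (m d : nat) (a : nat -> nat).
Hypotheses (d_ge1 : 1 <= d) (a0 : a 0 = 0) (an : a m.+1 = d).
Hypothesis a_incr : forall i, i < m.+1 -> a i < a i.+1.
Hypothesis iso : posets_iso m.+1 d a.

(** Here n is [m.+1]. The variable x_0 has index [ord0] for [g]; x_n has index [ord_max] for [h] and
    for [g \o lift ord0]. *)
Let g (i : 'I_m.+2) := gen2 d a i.
Let h (j : 'I_m.+1) := gen1 a j.+1.

Lemma pr_g0 : pr (g ord0) = (0, d).
Proof. by rewrite pr_gen2 a0 subn0. Qed.

Lemma pr_gmax : pr ((g \o lift ord0) ord_max) = (d, 0).
Proof. by rewrite pr_gen2 /= /bump /= an subnn. Qed.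

Lemma inS_g x : inS m.+1 d a (pr (wdeg g x)).
Proof.
by apply: (@wdeg_inS m.+1 d a _ (@nat_of_ord m.+2)) => i; rewrite -ltnS ltn_ord.
Qed.

Lemma inS_g0 x : inS m.+1 d a (pr (wdeg (g \o lift ord0) x)).
Proof.
apply: (@wdeg_inS m.+1 d a _ (fun j : 'I_m.+1 => lift ord0 j)) => i.
by rewrite -ltnS ltn_ord.
Qed.

Lemma leS_pr s t : inS m.+1 d a (pr s) -> leS m.+1 d a (pr t) (pr (s + t)%MM).
Proof.
move=> Ss; rewrite prD; apply/leSE; exists (pr s).1, (pr s).2.
by split; rewrite // addnC.
Qed.

Lemma leS_pr_wdeg s t : leS m.+1 d a (pr s) (pr t) ->
  exists x, (wdeg g x + s)%MM = t.
Proof.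
case tE : (pr t) => [t1 t2]; case sE : (pr s) => [s1 s2].
move=> /leSE[r1 [r2 [/inS_wdeg[x xE] E1 E2]]]; exists x; apply: pr_inj.
by rewrite prD [pr (wdeg _ _)]xE sE tE E1 E2 /= [r1 + _]addnC [r2 + _]addnC.
Qed.

Lemma left_shiftP t :
  (forall x, (wdeg g x + g ord0)%MM <> t) <-> ~ leS m.+1 d a (0, d) (pr t).
Proof.
rewrite -pr_g0; split=> [nt /leS_pr_wdeg[x /nt]|nle x xt] //.
by apply: nle; rewrite -xt; apply: leS_pr; apply: inS_g.
Qed.

(** The left side is the shape produced by [kill_toric_ideal] applied for x_0 and then x_n, starting
    from the trivial predicate. *)
Lemma inAPS_shiftP t : inS m.+1 d a (pr t) ->
  ((True /\ forall x, (wdeg g x + g ord0)%MM <> t) /\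
   forall x, (wdeg (g \o lift ord0) x + (g \o lift ord0) ord_max)%MM <> t) <->
  inAPS m.+1 d a (pr t).
Proof.
move=> St; split=> [[[_ nt nt']]|[_ [nle nle']]].
  split=> //; split; first exact/left_shiftP.
  rewrite -pr_gmax => /leS_pr_wdeg[x xE].
  have [x0|x_n0] := eqVneq (x ord0) 0.
    apply: (nt' [multinom x (lift ord0 j) | j < m.+1]).
    rewrite -xE; congr (_ + _)%MM; apply/mnmP => i.
    rewrite !wdegE [RHS](bigD1_ord ord0) //= x0 muln0 add0n.
    by apply: eq_bigr => j _; rewrite mnmE.
  (* If x_0 occurs in [x], the factors x_0 and x_n trade places, exhibiting [t] as the degree of a
     multiple of x_0. *)
  apply: (nt (x - U_(ord0) + U_(lift ord0 ord_max))%MM).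
  rewrite wdegD wdegU -addmA [(g _ + g _)%MM]addmC addmA -xE.
  by rewrite -(wdegU g ord0) -wdegD submK ?lep1mP.
split; first by split=> //; apply/left_shiftP.
move=> x xt; apply: nle'; rewrite -pr_gmax -xt; apply: leS_pr.
exact: inS_g0.
Qed.

Lemma inS1_h x : inS1 m.+1 a (wdeg h x ord0).
Proof.
by apply: (@wdeg_inS1 m.+1 d a _ (fun j : 'I_m.+1 => j.+1) x a0) => i.
Qed.

Lemma h_max : h ord_max ord0 = d.
Proof. by rewrite mnmE. Qed.

Lemma inAp1_shiftP (t : 'X_{1..1}) : inS1 m.+1 a (t ord0) ->
  (True /\ forall x, (wdeg h x + h ord_max)%MM <> t) <->
  inAp1 m.+1 d a (t ord0).
Proof.
move=> St; split=> [[_ nt]|[_ nle]].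
  split=> // /le1E[s /inS1_wdeg[x xE] tE].
  by apply: (nt x); apply: mnm1_inj; rewrite mnmDE h_max [wdeg _ _ _]xE tE addnC.
split=> // x xt; apply: nle; rewrite -xt mnmDE h_max; apply/le1E.
by exists (wdeg h x ord0); [apply: inS1_h | rewrite addnC].
Qed.

(** The weights of the middle variables x_1, .., x_(n-1) in the two cones. *)
Let g' (j : 'I_m) := g (lift ord0 (lift ord_max j : 'I_m.+1)).
Let h' (j : 'I_m) := h (lift ord_max j).

Lemma wdeg_g'h' x : (pr (wdeg g' x)).1 = wdeg h' x ord0.
Proof.
rewrite /pr !wdegE; apply: eq_bigr => i _.
by rewrite !mnmE.
Qed.

Lemma inS_g' x : inS m.+1 d a (pr (wdeg g' x)).
Proof.
apply: (@wdeg_inS m.+1 d a _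
  (fun j : 'I_m => lift ord0 (lift ord_max j : 'I_m.+1))) => i.
by rewrite -ltnS ltn_ord.
Qed.

Lemma inS1_h' x : inS1 m.+1 a (wdeg h' x ord0).
Proof. by rewrite -wdeg_g'h'; case: (pr _) (inS_g' x) => u v /(inS_inS1 a0). Qed.

(** From right to left, induct on the degree of the monomial: dividing by a variable stays in Ap_1,
    which is closed downwards, and [inAPS_step] multiplies back. *)
Lemma inAPS_inAp1 x :
  inAPS m.+1 d a (pr (wdeg g' x)) <-> inAp1 m.+1 d a (wdeg h' x ord0).
Proof.
split=> [|]; first by rewrite -wdeg_g'h' => /(inAPS_lift_Ap d_ge1 a0 an iso)[].
have [N] := ubnP (mdeg x); elim: N x => // N IH x ltN Ax.
have [->|x_n0] := eqVneq x 0%MM.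
  rewrite (_ : pr _ = (0, 0)); first exact: inAPS0.
  by rewrite /pr !wdegE !big1 // => i _; rewrite mnm0E muln0.
have [i xi] : exists i, x i != 0.
  apply/existsP; apply: contraR x_n0; rewrite negb_exists => /forallP x0.
  by apply/eqP/mnmP => i; rewrite mnm0E; apply/eqP; rewrite -[_ == _]negbK.
have xE : x = (x - U_(i) + U_(i))%MM by rewrite submK ?lep1mP.
have g'i : pr (g' i) = (a i.+1, d - a i.+1).
  by rewrite pr_gen2 /= /bump /= leqNgt ltn_ord.
have h'i : h' i ord0 = a i.+1 by rewrite mnmE /= /bump leqNgt ltn_ord.
rewrite xE wdegD wdegU mnmDE h'i in Ax.
rewrite xE wdegD wdegU prD g'i.
have Ab : inAPS m.+1 d a (pr (wdeg g' (x - U_(i)))).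
  apply: IH; first by move: ltN; rewrite {1}xE mdegD mdeg1; lia.
  have Sai : inS1 m.+1 a (a i.+1).
    by rewrite -h'i -(wdegU h'); apply: inS1_h'.
  exact: (inAp1_down a0 Ax (inS1_h' _) Sai (erefl _)).
rewrite -wdeg_g'h' in Ax.
case: (pr _) Ab Ax => u v Ab Ax.
by apply: (inAPS_step d_ge1 a0 an a_incr iso _ Ab Ax); rewrite //= ltnS.
Qed.

Variable k : fieldType.

(** [I1] describes the image of I_A modulo x_0; [J0] is I_{A_1}. *)
Let I1 : {mpoly k[m.+1]} -> Prop :=
  toric_ideal (g \o lift ord0)
    (fun t => True /\ forall x, (wdeg g x + g ord0)%MM <> t).
Let J0 : {mpoly k[m.+1]} -> Prop := toric_ideal h (fun=> True).

(** The degrees from which [(0, d)] cannot be removed are stable under adding [(d, 0)], by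
    [not_leS_left_add]. *)
Lemma I1_regular p : I1 ('X_ord_max * p)%R -> I1 p.
Proof.
apply: toric_ideal_mulX => x [_ /left_shiftP nle]; split=> //.
apply/left_shiftP; rewrite prD pr_gmax.
case: (pr _) (inS_g0 x) nle => u v; rewrite /= addn0.
exact: (not_leS_left_add d_ge1 a0 an iso).
Qed.

(** Both sides have the same surviving monomials, by [inAPS_inAp1], and the same coincidences of
    weights among them, as the projection is injective on AP_S. *)
Lemma kill_I1_J0 q :
  (exists2 p, I1 p & q = kill ord_max p) <-> (exists2 p, J0 p & q = kill ord_max p).
Proof.
rewrite !kill_toric_ideal.
have GP x : (True /\ (forall y, (wdeg g y + g ord0)%MM <> wdeg g' x)) /\
    (forall y, (wdeg (g \o lift ord0) y + (g \o lift ord0) ord_max)%MM <> wdeg g' x)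
    <-> inAPS m.+1 d a (pr (wdeg g' x)).
  exact: inAPS_shiftP (inS_g' x).
have HP x : (True /\ forall y, (wdeg h y + h ord_max)%MM <> wdeg h' x) <->
    inAp1 m.+1 d a (wdeg h' x ord0).
  exact: inAp1_shiftP (inS1_h' x).
have inj x y : inAPS m.+1 d a (pr (wdeg g' x)) ->
    inAPS m.+1 d a (pr (wdeg g' y)) ->
    wdeg g' x = wdeg g' y <-> wdeg h' x = wdeg h' y.
  move=> Ax Ay; split=> E.
    by apply: mnm1_inj; rewrite -!wdeg_g'h' E.
  apply: pr_inj; apply: (inAPS_inj d_ge1 a0 an iso Ax Ay).
  by rewrite !wdeg_g'h' E.
split; apply: toric_ideal_sub.
- by move=> x /HP/inAPS_inAp1/GP.
- by move=> x y /HP/inAPS_inAp1 Ax /HP/inAPS_inAp1 Ay; apply: inj.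
- by move=> x /GP/inAPS_inAp1/HP.
- by move=> x /GP/inAPS_inAp1/HP.
- by move=> x y /GP Ax /GP Ay; have [? ?] := inj x y Ax Ay.
- by move=> x /HP/inAPS_inAp1/GP.
Qed.

End Comparison.

(** * From graded resolutions to Betti numbers *)

Lemma min_graded_resolves (k : fieldType) N (w : 'I_N -> nat)
    (I : {mpoly k[N]} -> Prop) b D (phi : forall i, 'M_(b i.+1, b i)) :
  is_min_graded_res w I D phi -> resolves I phi.
Proof. by case. Qed.

(** The constant monomial has degree 0 for every weight [w], while nonzero entries are homogeneous
    of positive degree. *)
Lemma min_graded_mcoeff0 (k : fieldType) N (w : 'I_N -> nat)
    (I : {mpoly k[N]} -> Prop) b D (phi : forall i, 'M_(b i.+1, b i)) :
  is_min_graded_res w I D phi -> forall i l j, ((phi i l j)@_0%MM = 0)%R.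
Proof.
case=> _ _ H _ _ i l j; have [->|[lt_D wh]] := H i l j; first exact: mcoeff0.
apply: memN_msupp_eq0; apply/negP => /wh.
by rewrite big1 => [|x _]; rewrite ?mnm0E ?muln0 //; move: lt_D; lia.
Qed.

Lemma resolves_ext (R : comNzRingType) (I I' : R -> Prop) b
    (phi : forall i, 'M_(b i.+1, b i)) :
  (forall p, I p <-> I' p) -> resolves I phi -> resolves I' phi.
Proof.
move=> II' [b0 ex0 exS]; split=> // v; rewrite -ex0.
by split=> H j; apply/II'.
Qed.

Lemma kill_descent (k : fieldType) N (v : 'I_N.+1) (I : {mpoly k[N.+1]} -> Prop)
    b (phi : forall i, 'M_(b i.+1, b i)) :
  (forall p, I ('X_v * p)%R -> I p) -> resolves I phi ->
  resolves (fun q => exists2 p, I p & q = kill v p) (fun i => map_mx (kill v) (phi i)).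
Proof.
apply: (resolves_descent (@widen_mpolyK k N v)) => [||p]; last exact: kill_eq0.
  by apply/eqP => /(congr1 (mcoeff U_(v)%MM))/eqP; rewrite mcoeffX mcoeff0 eqxx oner_eq0.
exact: killXv.
Qed.

Theorem mainTheorem4 (k : fieldType) (n d : nat) (a : nat -> nat)
    (k_inf : forall s : seq k, exists x : k, x \notin s)
    (d_ge1 : (1 <= d)%N)
    (a0 : a 0%N = 0%N) (an : a n = d)
    (a_incr : forall i, (i < n)%N -> (a i < a i.+1)%N)
    (a_gcd : (\big[gcdn/0%N]_(1 <= i < n.+1) a i)%N = 1%N)
    (iso : posets_iso n d a)
    (beta beta1 : nat -> nat) :
  @betti_numbers k n.+1 (fun _ : 'I_n.+1 => 1%N) (@inIA k n d a) beta ->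
  @betti_numbers k n (fun j : 'I_n => a j.+1) (@inIA1 k n a) beta1 ->
  forall i, beta i = beta1 i.
Proof.
case: n => [|m] in an a_incr a_gcd iso *; first by move: d_ge1; rewrite -an a0.
move=> [D [phi min]] [D1 [phi1 min1]] i.
have res := resolves_ext (fun p => iff_trans (inIA_toric d a p)
  (iff_sym (toric_idealTE _ p))) (min_graded_resolves min).
(* Reduce modulo x_0, then modulo x_n, rewriting the resolved ideal after each reduction. *)
have {}res := kill_descent (v := ord0) (@toric_regular k _ _ _ _) res.
have {}res := resolves_ext (fun p => kill_toric_ideal _ _ _ p) res.
have {}res := kill_descent (I1_regular d_ge1 a0 an iso (k := k)) res.
have {}res := resolves_ext (kill_I1_J0 d_ge1 a0 an a_incr iso (k := k)) res.
have res1 := resolves_ext (fun p => iff_trans (inIA1_toric a p)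
  (iff_sym (toric_idealTE _ p))) (min_graded_resolves min1).
have {}res1 := kill_descent (v := ord_max) (@toric_regular k _ _ _ _) res1.
(* Both reduced resolutions now resolve the same ideal of k[x_1, .., x_(n-1)], with all entries
   vanishing at the origin. *)
apply/eqP; rewrite eqn_leq; apply/andP; split.
  apply: (min_resolution_rank_le (eps := mcoeff 0%MM) res res1) => i' l j.
  by rewrite !mxE /= !mcoeff0_kill (min_graded_mcoeff0 min).
apply: (min_resolution_rank_le (eps := mcoeff 0%MM) res1 res) => i' l j.
by rewrite mxE /= mcoeff0_kill (min_graded_mcoeff0 min1).
Qed.
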